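(* There exist real numbers $\alpha, \beta$ such that $1,\alpha,\beta$ are linearly independent over $\mathbb{Q}$, and a continuous function $\rho: \mathbb{T}^1 \to \mathbb{C}$, such that the homeomorphism $$F: \mathbb{T}^1 \times \mathbb{C} \to \mathbb{T}^1 \times \mathbb{C}, \qquad F(x,z) = \big( x+\alpha, \ e^{2\pi i \beta} z + \rho(x) \big)$$ is topologically transitive.
   Context: $\mathbb{T}^1 = \mathbb{R}/\mathbb{Z}$. A homeomorphism is topologically transitive if it has a point whose orbit is dense in the whole space. *)

(* Defs.v *)
From HB Require Import structures.
From mathcomp Require Import all_boot all_order all_algebra.
From mathcomp Require Import generic_quotient ring_quotient.
From mathcomp Require Import complex.
From mathcomp Require Import all_classical all_reals all_analysis.

Set Implicit Arguments.
Unset Strict Implicit.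
Unset Printing Implicit Defensive.

Import Order.TTheory GRing.Theory Num.Theory numFieldNormedType.Exports.

Local Open Scope classical_set_scope.
Local Open Scope quotient_scope.
Local Open Scope complex_scope.
Local Open Scope ring_scope.

Definition int_subgroup (R : realType) : zmodClosed R :=
  GRing.ZmodClosed.clone R (@Num.int_num_subdef R) _.

(* R/Z: the quotient group of R by its subgroup of integers, with the quotient
   topology.  The canonical projection is \pi_(circle R). *)
Definition circle (R : realType) : Type :=
  quotient_topology (Quotient.quot (int_subgroup R)).

HB.instance Definition _ (R : realType) := Topological.on (circle R).
HB.instance Definition _ (R : realType) := Quotient.on (circle R).
HB.instance Definition _ (R : realType) :=
  GRing.Zmodule.copy (circle R) (Quotient.quot (int_subgroup R)).

Definition lin_indep_rat (R : realType) (n : nat) (v : n.-tuple R) : Prop :=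
  forall c : 'I_n -> rat,
    \sum_(i < n) ratr (c i) * tnth v i = 0 -> forall i, c i = 0.

Definition cexp (R : realType) (z : R[i]) : R[i] :=
  (expR (complex.Re z))%:C * (cos (complex.Im z) +i* sin (complex.Im z)).

Definition homeomorphism (X Y : topologicalType) (f : X -> Y) : Prop :=
  continuous f /\
  exists g : Y -> X, [/\ cancel f g, cancel g f & continuous g].

(* For bijective f, the two-sided orbit {f^n(x) | n in Z}: the equation
   iter n f y = x says that y = f^(-n)(x). *)
Definition full_orbit (X : Type) (f : X -> X) (x : X) : set X :=
  [set y | exists n : nat, y = iter n f x \/ iter n f y = x].

Definition topologically_transitive (X : topologicalType) (f : X -> X) : Prop :=
  exists x : X, dense (full_orbit f x).

(* R[i]^o is the field R[i] carrying the topology of its modulus. *)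
Definition cylinder_map (R : realType) (alpha beta : R)
    (rho : circle R -> R[i]^o) (p : circle R * R[i]^o) :
    circle R * R[i]^o :=
  (p.1 + \pi_(circle R) alpha,
   cexp ((2 * pi)%:C * 'i * beta%:C) * p.2 + rho p.1).

(* Main.v *)
Require Import Defs.
From mathcomp Require Import all_boot all_order all_algebra.
From mathcomp Require Import generic_quotient ring_quotient.
From mathcomp Require Import complex.
From mathcomp Require Import all_classical all_reals all_analysis.
From mathcomp Require Import ring lra zify.
Import Order.TTheory GRing.Theory Num.Theory.
Import numFieldNormedType.Exports.
Local Open Scope ring_scope.

Set Implicit Arguments.
Unset Strict Implicit.
Unset Printing Implicit Defensive.

(** Write $e(t) = \exp(2\pi i t)$ and fix an irrational $a$.  If $\rho$ is a twisted
    coboundary, $\rho(y) = h(y + a) - e(b) h(y)$ with $h$ continuous and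
    periodic, then the cylinder map sends $(0, 0)$ after $n$ steps to
    $(na, h(na) - e(nb) h(0))$, so orbits stay bounded.  The required $\rho$ is a
    uniform limit of such coboundaries whose functions $h$ do not converge.

    The mechanism is a resonance.  When $b = ma$ modulo 1, adding a multiple
    $d\,e(my)$ of a character to $h$ does not change $\rho$, however large $d$
    is.  If $b$ is then moved by $-1/(2n)$, the numbers $e(mna)$ and $e(nb)$
    become opposite at time $n$, and the new term contributes $2d\,e(mna)$ to the
    orbit of $(0, 0)$.  Given a target $(x, z)$, one chooses first $d$ so that
    this contribution produces $z$ over the base point $x$, and only then a large
    $n$ with $na$ close to $x$: the orbit passes near the target at time $n$,
    although $b$ and $\rho$ have hardly moved.  As the numbers $ma$ are dense
    modulo 1, a further small change of $b$ restores a resonance with another $m$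
    and the next target can be treated ([reach_target]).

    Each stage confines $b$ to a closed interval on which the estimates hold.
    The intervals are nested, the coboundaries at their common point converge
    uniformly, and all visits to targets survive in the limit
    ([cylinder_orbit_dense]).  Every stage also excludes one number from the
    interval; excluding in turn all of $\mathbb{Q} + \mathbb{Q}a$ makes
    $1, a, b$ rationally independent. *)

(** * Irrational rotations of the circle *)

Lemma sqrt2_irrational (R : realType) (q : rat) : ratr q != Num.sqrt 2 :> R.
Proof.
apply/eqP => h.
have h2 : q ^+ 2 = 2.
  apply: (fmorph_inj (ratr : rat -> R)).
  by rewrite rmorphXn /= h sqr_sqrtr ?ler0n // rmorph_nat.
have : (numq q ^+ 2 = 2 * denq q ^+ 2)%R.
  apply: (intr_inj (R := rat)).
  by rewrite !expr2 !intrM numqE mulrACA -expr2 h2.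
move/(congr1 absz); rewrite abszM !abszX /=.
move/(congr1 (logn 2)); rewrite lognM ?expn_gt0 ?absz_denq // ?lognX; last first.
  by rewrite absz_gt0 denq_neq0.
by rewrite (_ : logn 2 2 = 1%N) //; lia.
Qed.

(** Among the $M + 1$ fractional parts of $0, a, \dots, Ma$, two lie in the same
    interval of length $1/M$. *)
Lemma dirichlet (R : realType) (a e : R) : 0 < e ->
  exists q : nat, exists p : int, (0 < q)%N /\ `|q%:R * a - p%:~R| < e.
Proof.
move=> e0.
pose M := (Num.trunc e^-1).+1.
have M0 : 0 < M%:R :> R by rewrite ltr0n.
have eM : M%:R^-1 < e.
  by rewrite -[e]invrK ltf_pV2 ?posrE ?invr_gt0 // truncnS_gt.
pose fr (i : nat) : R := i%:R * a - (Num.floor (i%:R * a))%:~R.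
have frP i : 0 <= fr i < 1.
  have := floor_itv (i%:R * a); rewrite /fr intrD; lra.
have fM i : (Num.trunc (M%:R * fr i) < M)%N.
  have /andP[f0 f1] := frP i.
  rewrite -(ltr_nat R); apply: (@le_lt_trans _ _ (M%:R * fr i)).
    by have /andP[] := truncn_itv (mulr_ge0 (ltW M0) f0).
  by rewrite -[ltRHS]mulr1 ltr_pM2l.
pose f (i : 'I_M.+1) : 'I_M := Ordinal (fM i).
have [i [j [ij fij]]] : exists i j : 'I_M.+1, (i < j)%N /\ f i = f j.
  apply: contrapT => H.
  have /leq_card : injective f.
    move=> i j fij; apply/val_inj => /=.
    case: (ltngtP i j) => // ij; exfalso; apply: H.
      by exists i, j.
    by exists j, i.
  by rewrite !card_ord ltnn.
exists (j - i)%N, (Num.floor (j%:R * a) - Num.floor (i%:R * a)).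
split; first by rewrite subn_gt0.
have -> : (j - i)%:R * a - (Num.floor (j%:R * a) - Num.floor (i%:R * a))%:~R
   = fr j - fr i.
  by rewrite /fr natrB ?(ltnW ij) // intrB; ring.
apply: lt_trans eM.
have /(congr1 val) /= tij := fij.
have /andP[i0 i1] := frP i; have /andP[j0 j1] := frP j.
have /andP[] := truncn_itv (mulr_ge0 (ltW M0) i0).
have /andP[] := truncn_itv (mulr_ge0 (ltW M0) j0).
rewrite -tij => t1 t2 t3 t4.
rewrite -(ltr_pM2l M0) mulfV ?gt_eqF // -[X in X * `|_|](gtr0_norm M0) -normrM.
move: t1 t2 t3 t4; rewrite -natr1 => t1 t2 t3 t4.
rewrite ltr_norml mulrBr; lra.
Qed.

(** The integer multiples of a small nonzero $t = qa - p$ form a fine net of the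
    real line; the sign of $t$ decides in which direction to walk so that the
    multiple, hence $n$, is positive and large. *)
Lemma irrational_rotation_dense (R : realType) (a x e : R) (N : nat) :
  (forall q : rat, ratr q != a) -> 0 < e ->
  exists n : nat, exists k : int, (N < n)%N /\ `|n%:R * a - k%:~R - x| < e.
Proof.
move=> irr e0.
have [q [p [q0 qp]]] := dirichlet a e0.
set t := q%:R * a - p%:~R in qp.
have q0R : 0 < q%:R :> R by rewrite ltr0n.
have t0 : t != 0.
  apply/eqP => /eqP; rewrite subr_eq0 => /eqP h.
  have /eqP[] := irr (p%:~R / q%:R).
  by rewrite fmorph_div /= ratr_int ratr_nat -h mulrC mulKf ?gt_eqF.
(* An integer l makes (x + l) / t exceed N + 1, whatever the sign of t. *)
have [l hl] : exists l : int, N.+1%:R <= (x + l%:~R) / t.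
  pose c := N.+1%:R * `|t| + `|x|.
  have c0 : 0 <= c by rewrite addr_ge0 ?mulr_ge0.
  have cl : c < (Num.floor c + 1)%:~R by have /andP[] := floor_itv c.
  have hx := ler_norm x; have hx' := ler_norm (- x).
  rewrite normrN in hx'.
  case: (ltrgtP t 0) => ht; last by rewrite ht eqxx in t0.
    exists (- (Num.floor c + 1)); rewrite ler_ndivlMr // rmorphN /=.
    move: cl; rewrite /c (ltr0_norm ht); lra.
  exists (Num.floor c + 1); rewrite ler_pdivlMr //.
  by move: cl; rewrite /c (gtr0_norm ht); lra.
pose s := Num.trunc ((x + l%:~R) / t).
have /andP[s1 s2] := truncn_itv (le_trans (ler0n _ _) hl).
have sN : (N < s)%N.
  by rewrite -ltnS -(ltr_nat R); apply: le_lt_trans s2.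
exists (s * q)%N, (s%:Z * p + l); split.
  by rewrite (leq_trans sN) // leq_pmulr.
have -> : (s * q)%:R * a - (s%:Z * p + l)%:~R - x = s%:R * t - (x + l%:~R).
  by rewrite /t natrM intrD intrM; ring.
have -> : s%:R * t - (x + l%:~R) = (s%:R - (x + l%:~R) / t) * t.
  by rewrite mulrBl divfK.
apply: le_lt_trans qp; rewrite normrM ler_piMl // ler_norml.
by move: s1 s2; rewrite -/s -natr1; lra.
Qed.

(** * The complex modulus and the characters of the circle *)

Section Complex.
Variable R : realType.
Implicit Types (z w : R[i]) (s t : R).
Local Notation modulus := (@Normc.normc R).

(** The norm of [R[i]] takes its values in [R[i]]; estimates are carried out with
    its real counterpart. *)
Lemma norm_modulus z : `|z| = (modulus z)%:C%C.
Proof. by case: z => x y; rewrite normc_def. Qed.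

Lemma modulusM z w : modulus (z * w) = modulus z * modulus w.
Proof. exact: Normc.normcM. Qed.

Lemma modulusD z w : modulus (z + w) <= modulus z + modulus w.
Proof. exact: (@le_normcD R z w). Qed.

Lemma modulusN z : modulus (- z) = modulus z.
Proof. exact: (@normcN R z). Qed.

Lemma modulus_distC z w : modulus (z - w) = modulus (w - z).
Proof. by rewrite -modulusN opprB. Qed.

Lemma modulus_dist_trans v z w :
  modulus (z - w) <= modulus (z - v) + modulus (v - w).
Proof. by rewrite (_ : z - w = (z - v) + (v - w)) ?modulusD //; ring. Qed.

Lemma modulus_real t : modulus t%:C%C = `|t|.
Proof. by rewrite /= expr0n addr0 sqrtr_sqr. Qed.

Lemma modulus_ReIm z : modulus z <= `|complex.Re z| + `|complex.Im z|.
Proof.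
case: z => x y /=.
rewrite -[leRHS]ger0_norm ?addr_ge0 // -sqrtr_sqr ler_wsqrtr //.
rewrite sqrrD !real_normK ?num_real // -subr_ge0.
by rewrite (_ : _ - _ = `|x| * `|y| *+ 2); [rewrite mulrn_wge0 ?mulr_ge0|ring].
Qed.

Lemma Re_modulus z : `|complex.Re z| <= modulus z.
Proof. by rewrite -lecR -norm_modulus normc_ge_Re. Qed.

Lemma Im_modulus z : `|complex.Im z| <= modulus z.
Proof.
case: z => x y /=; rewrite -sqrtr_sqr ler_wsqrtr // lerDr sqr_ge0 //.
Qed.

Lemma gt0_complex_real (e : R[i]) : 0 < e -> exists2 r : R, 0 < r & e = r%:C%C.
Proof.
by case: e => x y; rewrite ltcE /= => /andP[/eqP -> x0]; exists x.
Qed.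

Lemma cvg_modulusP (T : Type) (F : set_system T) (FF : Filter F)
    (f : T -> R[i]^o) (l : R[i]^o) :
  (f x @[x --> F] --> l)%classic <->
  forall e : R, 0 < e -> \forall x \near F, modulus (l - f x) < e.
Proof.
rewrite cvgrPdist_lt; split => [H e e0|H e e0].
  have := H e%:C%C; rewrite ltcR => /(_ e0).
  by apply: filterS => x; rewrite norm_modulus ltcR.
have [r r0 ->] := gt0_complex_real e0.
by apply: filterS (H _ r0) => x; rewrite norm_modulus ltcR.
Qed.

Lemma real_complex_continuous : continuous (fun t : R => t%:C%C : R[i]^o).
Proof.
move=> t; apply/cvg_modulusP => e e0.
near=> s.
rewrite -rmorphB modulus_real.
by near: s; apply: cvgr_dist_lt.
Unshelve. all: by end_near.
Qed.

Definition unit_exp t : R[i] :=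
  Complex (cos (2 * pi * t)) (sin (2 * pi * t)).

Lemma cexp_unit_exp t : cexp ((2 * pi)%:C%C * 'i * t%:C%C) = unit_exp t.
Proof.
have -> : (2 * pi)%:C%C * 'i * t%:C%C = Complex 0 (2 * pi * t) :> R[i].
  by apply/eqP; rewrite eq_complex /=; apply/andP; split; apply/eqP; ring.
by rewrite /cexp /= expR0 mul1r.
Qed.

Lemma unit_expD s t : unit_exp (s + t) = unit_exp s * unit_exp t.
Proof.
rewrite /unit_exp mulrDr cosD sinD; apply/eqP; rewrite eq_complex /=.
by rewrite eqxx /= addrC.
Qed.

Lemma unit_exp0 : unit_exp 0 = 1.
Proof. by rewrite /unit_exp mulr0 cos0 sin0. Qed.

Lemma unit_expN t : unit_exp (- t) * unit_exp t = 1.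
Proof. by rewrite -unit_expD addNr unit_exp0. Qed.

Lemma unit_exp_half : unit_exp 2^-1 = -1.
Proof.
rewrite /unit_exp mulrAC mulfV ?pnatr_eq0 // mul1r cospi sinpi.
by apply/eqP; rewrite eq_complex /= oppr0 !eqxx.
Qed.

Lemma unit_exp_nat n : unit_exp n%:R = 1.
Proof.
elim: n => [|n IH]; first exact: unit_exp0.
rewrite -natr1 unit_expD IH mul1r [1 in LHS]splitr unit_expD.
by rewrite div1r unit_exp_half mulrNN mulr1.
Qed.

Lemma unit_exp_int (k : int) : unit_exp k%:~R = 1.
Proof.
case: k => n; first exact: unit_exp_nat.
by have := unit_expN n.+1%:R; rewrite unit_exp_nat mulr1 NegzE rmorphN.
Qed.

Lemma unit_expDint t (k : int) : unit_exp (t + k%:~R) = unit_exp t.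
Proof. by rewrite unit_expD unit_exp_int mulr1. Qed.

Lemma modulus_unit_exp t : modulus (unit_exp t) = 1.
Proof. by rewrite /= cos2Dsin2 sqrtr1. Qed.

Lemma unit_exp_continuous : continuous (unit_exp : R -> R[i]^o).
Proof.
have -> : unit_exp =
    (fun t => (cos (2 * pi * t))%:C%C + 'i%C * (sin (2 * pi * t))%:C%C).
  by apply/funext => t; rewrite [LHS]complexE.
move=> t; apply: cvgD; last apply: cvgMl_tmp.
  apply: (@continuous_comp _ _ _ (fun t => cos (2 * pi * t)) (fun t : R => t%:C%C : R[i]^o)).
    apply: continuous_comp; last exact: continuous_cos.
    by apply: cvgMl_tmp; exact: cvg_id.
  exact: real_complex_continuous.
apply: (@continuous_comp _ _ _ (fun t => sin (2 * pi * t)) (fun t : R => t%:C%C : R[i]^o)).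
  apply: continuous_comp; last exact: continuous_sin.
  by apply: cvgMl_tmp; exact: cvg_id.
exact: real_complex_continuous.
Qed.

Lemma nested_intervals (a b : nat -> R) :
  (forall j, a j <= a j.+1) -> (forall j, b j.+1 <= b j) ->
  (forall j, a j <= b j) -> exists l, forall j, a j <= l <= b j.
Proof.
move=> ha hb hab.
have ma i j : (i <= j)%N -> a i <= a j.
  by apply: (@homo_leq _ _ (fun x y => x <= y)) => // y x z; exact: le_trans.
have mb i j : (i <= j)%N -> b j <= b i.
  by apply: (@homo_leq _ _ (fun x y => y <= x)) => // y x z h1 h2; exact: le_trans h2 h1.
have ub i : ubound (range a) (b i).
  move=> _ [j _ <-].
  apply: (le_trans (ma _ _ (leq_maxl j i))).
  by apply: (le_trans (hab _)); apply: mb; rewrite leq_maxr.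
have sa : has_sup (range a) by split; [exists (a 0%N), 0%N|exists (b 0%N)].
exists (sup (range a)) => j; apply/andP; split.
  by apply: ub_le_sup; [exists (b 0%N)|exists j].
by apply: ge_sup; [exists (a 0%N), 0%N|].
Qed.

(** The intervals of radius $2 \cdot 2^{-j}$ around $u_j$ are nested. *)
Lemma geometric_cauchy_real (u : nat -> R) :
  (forall j, `|u j.+1 - u j| <= 2^-1 ^+ j) ->
  exists l, forall j, `|l - u j| <= 2 * 2^-1 ^+ j.
Proof.
move=> hu.
have p0 j : 0 < 2^-1 ^+ j :> R by rewrite exprn_gt0 // invr_gt0 ltr0n.
have [j|j|j|l hl] := @nested_intervals (fun j => u j - 2 * 2^-1 ^+ j)
  (fun j => u j + 2 * 2^-1 ^+ j).
- by have := hu j; rewrite exprS ler_norml; move: (p0 j); lra.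
- by have := hu j; rewrite exprS ler_norml; move: (p0 j); lra.
- by move: (p0 j); lra.
- by exists l => j; have := hl j; rewrite ler_norml; lra.
Qed.

Lemma geometric_cauchy (u : nat -> R[i]) :
  (forall j, modulus (u j.+1 - u j) <= 2^-1 ^+ j) ->
  exists l, forall j, modulus (l - u j) <= 4 * 2^-1 ^+ j.
Proof.
move=> hu.
have ReB z w : complex.Re (z - w) = complex.Re z - complex.Re w.
  by case: z w => ? ? [].
have ImB z w : complex.Im (z - w) = complex.Im z - complex.Im w.
  by case: z w => ? ? [].
have [j|x hx] := @geometric_cauchy_real (fun j => complex.Re (u j)).
  by rewrite /= -ReB; apply: le_trans (hu j); exact: Re_modulus.
have [j|y hy] := @geometric_cauchy_real (fun j => complex.Im (u j)).
  by rewrite /= -ImB; apply: le_trans (hu j); exact: Im_modulus.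
exists (Complex x y) => j; apply: le_trans (modulus_ReIm _) _.
by rewrite ReB ImB /=; have := hx j; have := hy j; rewrite /=; lra.
Qed.
End Complex.

(** * Reaching one target by a small perturbation *)

Section Perturbation.
Variable R : realType.
Local Notation modulus := (@Normc.normc R).

Lemma add_character_continuous (h : R -> R[i]^o) (d : R[i]) (a : R) :
  continuous h ->
  continuous (fun y => h y + d * unit_exp (a * y) : R[i]^o).
Proof.
move=> ch y; apply: cvgD; first exact: ch.
apply: cvgMl_tmp.
apply: (@continuous_comp _ _ _ (fun y : R => a * y) (@unit_exp R : R -> R[i]^o)).
  by apply: cvgMl_tmp; exact: cvg_id.
exact: unit_exp_continuous.
Qed.

Lemma continuous_modulus_ball (f : R -> R[i]^o) (t e : R) :
  {for t, continuous f} -> 0 < e -> exists2 eta, 0 < eta &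
  forall s, `|s - t| < eta -> modulus (f s - f t) < e.
Proof.
move=> cf e0.
have /cvg_modulusP/(_ _ e0)/nbhs_ballP[eta eta0 H] := cf.
exists eta => // s st; rewrite modulus_distC; apply: H.
by rewrite /ball /= distrC.
Qed.

(** The parameters start at the resonance $b_0 = ma - l$.  The amplitude $d$ is
    chosen so that $g(y) = h'(y) + e(my) h'(0)$ takes the value $z$ at $x$; $g(na)$
    is the position at time $n$ when $b = b_0 - 1/(2n)$.  The bound over $k \le N$
    says that the added term is not yet felt up to time $N$. *)
Lemma reach_target (a : R) (m l : int) (r x q e : R) (h : R -> R[i]^o) (N : nat)
    (z : R[i]) :
  (forall c : rat, ratr c != a) -> 0 < r -> 0 < e -> continuous h ->
  (forall y (k : int), h (y + k%:~R) = h y) ->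
  exists d : R[i], exists m' l' : int, exists r' : R, exists N' : nat,
  let h' := fun y => h y + d * unit_exp (m%:~R * y) in
  [/\ 0 < r', (N < N')%N,
      exists k : int, `|N'%:R * a - k%:~R - x| < e &
      forall b, `|b - (m'%:~R * a - l'%:~R)| <= r' ->
      [/\ `|b - (m%:~R * a - l%:~R)| <= r, b != q,
       forall k : nat, (k <= N)%N ->
         modulus (d * (unit_exp (m%:~R * (k%:R * a)) - unit_exp (k%:R * b)))
           <= e &
       modulus (h' (N'%:R * a) - unit_exp (N'%:R * b) * h' 0 - z) < e]].
Proof.
move=> irr r0 e0 ch ph.
pose d := (unit_exp (- (m%:~R * x)) * (z - h x) - h 0) / 2.
pose h' y : R[i]^o := h y + d * unit_exp (m%:~R * y).
have ch' : continuous h' by exact: add_character_continuous.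
pose g y : R[i]^o := h' y + h' 0 * unit_exp (m%:~R * y).
have cg : continuous g by exact: add_character_continuous.
have pg y (k : int) : g (y + k%:~R) = g y.
  rewrite /g /h' ph mulrDr -intrM unit_expDint.
  by rewrite mulr0 unit_exp0.
have gx : g x = z.
  rewrite /g /h' mulr0 unit_exp0 mulr1.
  have E : unit_exp (- (m%:~R * x)) * unit_exp (m%:~R * x) = 1 :> R[i].
    exact: unit_expN.
  have dE : d + d = unit_exp (- (m%:~R * x)) * (z - h x) - h 0.
    by rewrite /d -splitr.
  rewrite -addrA -mulrDl [d + _]addrCA dE [h 0 + _]addrC subrK.
  by rewrite mulrAC E mul1r addrC subrK.
have e20 : 0 < e / 2 by rewrite divr_gt0.
have [dl dl0 Hdl] := continuous_modulus_ball (cg x) e20.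
pose b := m%:~R * a - l%:~R.
have expb (k : nat) : unit_exp (k%:R * b) = unit_exp (m%:~R * (k%:R * a)) :> R[i].
  rewrite /b mulrBr -[k%:R * l%:~R](intrM R k l) -rmorphN unit_expDint.
  by congr unit_exp; ring.
have [eta1 eta10 H1] : exists2 eta1, 0 < eta1 & forall s, `|s - b| < eta1 ->
    forall k : nat, (k <= N)%N ->
    modulus (d * (unit_exp (m%:~R * (k%:R * a)) - unit_exp (k%:R * s))) <= e.
  pose P (k : 'I_N.+1) s := modulus
    (d * (unit_exp (m%:~R * (k%:R * a)) - unit_exp (k%:R * s))) < e.
  have HP k : nbhs (b : R) (P k : set R).
    have cu : continuous (fun s : R => d * unit_exp (k%:R * s) : R[i]^o).
      move=> s; apply: cvgMl_tmp.
      apply: (@continuous_comp _ _ _ (fun y : R => k%:R * y) (@unit_exp R : R -> R[i]^o)).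
        by apply: cvgMl_tmp; exact: cvg_id.
      exact: unit_exp_continuous.
    have /cvg_modulusP/(_ _ e0) cub := cu b.
    by apply: filterS cub => s; rewrite /P -expb [d * (_ - _)]mulrBr.
  have := filter_forall (nbhs_filter b) HP.
  move=> /nbhs_ballP[eta1 eta10 H]; exists eta1 => // s st k kN.
  apply/ltW; have := H s; rewrite /ball /= distrC => /(_ st (Ordinal (kN : (k < N.+1)%N))).
  by [].
pose eta0 := Num.min eta1 r.
have eta00 : 0 < eta0 by rewrite lt_min eta10.
have de0 : 0 < Num.min dl e by rewrite lt_min dl0.
have [n [k [nN nk]]] :=
  irrational_rotation_dense x (N + Num.trunc eta0^-1)%N irr de0.
move: nk; rewrite lt_min => /andP[nkdl nke].
have n0 : 0 < n%:R :> R by rewrite ltr0n; apply: leq_trans nN.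
have ieta : n%:R^-1 < eta0.
  rewrite -[eta0]invrK ltf_pV2 ?posrE ?invr_gt0 //.
  apply: (lt_le_trans (truncnS_gt _)); rewrite ler_nat.
  by apply: leq_trans nN; rewrite ltnS leq_addl.
have in0 : 0 < n%:R^-1 :> R by rewrite invr_gt0.
(* For the parameter bs, unit_exp (n * bs) is opposite to unit_exp (m * (n * a)),
   so the last term of h' contributes twice its value at n * a. *)
pose bs := b - n%:R^-1 / 2.
have expbs : unit_exp (n%:R * bs) = - unit_exp (m%:~R * (n%:R * a)) :> R[i].
  rewrite -expb (_ : n%:R * b = n%:R * bs + 2^-1).
    by rewrite unit_expD unit_exp_half mulrN1 opprK.
  by rewrite /bs; field; rewrite gt_eqF.
pose G s : R[i]^o := h' (n%:R * a) + (- h' 0) * unit_exp (n%:R * s).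
have cG : continuous G.
  by apply: add_character_continuous => s; exact: cvg_cst.
have Gbs : modulus (G bs - z) < e / 2.
  rewrite /G expbs mulNr mulrN opprK -[h' _ + _]/(g (n%:R * a)).
  rewrite -[n%:R * a](subrK k%:~R) pg -gx; apply: Hdl.
  exact: nkdl.
have [eta2 eta20 H2] := continuous_modulus_ball (cG bs) e20.
pose eta := Num.min eta2 (eta0 / 2).
have eta_gt0 : 0 < eta by rewrite lt_min eta20 divr_gt0.
(* y is on the side of bs opposite to q, so a whole interval around y avoids q. *)
pose y := if bs <= q then bs - eta / 2 else bs + eta / 2.
have yP t : `|t - y| < eta / 4 -> `|t - bs| < eta /\ t != q.
  rewrite !ltr_norml /y => ty; split; first by move: ty; case: ifP => _; lra.
  apply/eqP => tq; move: ty; rewrite tq.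
  by case: ifP => [|/negbT]; rewrite -?ltNge; lra.
have eta80 : 0 < eta / 8 by rewrite divr_gt0.
have [m' [l' [_ m'l']]] := irrational_rotation_dense y 0%N irr eta80.
exists d, m', l', (eta / 8), n; split => //.
- by apply: leq_ltn_trans nN; rewrite leq_addr.
- by exists k.
move=> t ht.
have [tbs tq] : `|t - bs| < eta /\ t != q.
  apply: yP; move: ht m'l'; rewrite ler_norml !ltr_norml -pmulrn; lra.
have tb : `|t - b| < eta0.
  move: tbs; have : eta <= eta0 / 2 by rewrite ge_min lexx orbT.
  rewrite /bs !ltr_norml; lra.
split => //.
- by apply/ltW/(lt_le_trans tb); rewrite ge_min lexx orbT.
- move=> j jN; apply: H1 => //; apply: (lt_le_trans tb).
  by rewrite ge_min lexx.
have Gt : modulus (G t - G bs) < e / 2.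
  by apply: H2; apply: (lt_le_trans tbs); rewrite ge_min lexx.
have -> : h (n%:R * a) + d * unit_exp (m%:~R * (n%:R * a)) -
    unit_exp (n%:R * t) * (h 0 + d * unit_exp (m%:~R * 0)) = G t.
  by rewrite /G mulNr [h' 0 * _]mulrC.
rewrite [e]splitr; apply: le_lt_trans (modulus_dist_trans (G bs) _ _) _.
exact: ltrD.
Qed.
End Perturbation.

(** * The inductive construction *)

(** Every element is listed infinitely often because all numbers $2^k(2N + 1)$
    carry the element of code $k$. *)
Lemma recurrent_enumeration (T : countType) (t0 : T) :
  exists f : nat -> T, forall t N, exists2 j, (N <= j)%N & f j = t.
Proof.
exists (fun j => odflt t0 (choice.unpickle (logn 2 j))) => t N.
exists (2 ^ choice.pickle t * N.*2.+1)%N.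
  apply: leq_trans (leq_pmull _ _); last by rewrite expn_gt0.
  by rewrite -addnn -addSn leq_addl.
rewrite lognM ?expn_gt0 // pfactorK // (@logn_coprime 2 N.*2.+1); last first.
  by rewrite coprime2n /= odd_double.
by rewrite addn0 choice.pickleK.
Qed.

Lemma half_power_small (R : realType) (e : R) (N : nat) : 0 < e ->
  exists2 j, (N <= j)%N & 2^-1 ^+ j < e.
Proof.
move=> e0; exists (N + (Num.trunc e^-1).+1)%N; first exact: leq_addr.
rewrite exprVn -[ltRHS]invrK ltf_pV2 ?posrE ?exprn_gt0 ?invr_gt0 //.
apply: (lt_trans (truncnS_gt _)); rewrite -natrX ltr_nat.
by apply: leq_trans (ltn_expl _ (ltnSn 1)) _; rewrite leq_exp2l // leq_addl.
Qed.

Section Construction.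
Variables (R : realType) (a : R).
Hypothesis irr : forall c : rat, ratr c != a.
Local Notation modulus := (@Normc.normc R).

(** The parameter $b$ is confined to the interval of radius [rad] around the
    resonance [mult] * a - [shift], [pot] is the function $h$ whose twisted
    coboundary approximates $\rho$, and [time] is the time of the last visit. *)
Record stage := Stage {
  mult : int; shift : int; rad : R; pot : R -> R[i]^o; time : nat }.

Definition freq (s : stage) : R := (mult s)%:~R * a - (shift s)%:~R.

Definition valid (s : stage) : Prop :=
  [/\ 0 < rad s, continuous (pot s),
      forall y (k : int), pot s (y + k%:~R) = pot s y & (0 < time s)%N].

(** The fibre coordinate at time $n$ of the orbit of $(0, 0)$ when $\rho$ is the
    twisted coboundary of [h]. *)
Definition cocycle (h : R -> R[i]) (b : R) (n : nat) : R[i] :=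
  h (n%:R * a) - unit_exp (n%:R * b) * h 0.

Definition coboundary (h : R -> R[i]) (b y : R) : R[i] :=
  h (y + a) - unit_exp b * h y.

(** All requirements on $b$ hold on the whole interval of the new stage, so they
    pass to the intersection of the intervals.  The bound over $k \le$ [time s]
    controls the change of the coboundary ($k = 1$) and keeps the earlier visits. *)
Definition refines (e x q : R) (z : R[i]) (s t : stage) : Prop :=
  [/\ valid t, (time s < time t)%N,
      exists k : int, `|(time t)%:R * a - k%:~R - x| < e &
      exists2 d : R[i],
        pot t = (fun y => pot s y + d * unit_exp ((mult s)%:~R * y)) &
      forall b, `|b - freq t| <= rad t ->
      [/\ `|b - freq s| <= rad s, b != q,
       forall k : nat, (k <= time s)%N ->
         modulus (d * (unit_exp ((mult s)%:~R * (k%:R * a))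
                       - unit_exp (k%:R * b))) <= e &
       modulus (cocycle (pot t) b (time t) - z) < e]].

Lemma refines_exists e x q z s : 0 < e -> valid s ->
  exists t, refines e x q z s t.
Proof.
move=> e0 [r0 ch ph n0].
have [d [m' [l' [r' [n' [r'0 nn' hk H]]]]]] :=
  reach_target (mult s) (shift s) x q (time s) z irr r0 e0 ch ph.
pose h' y : R[i]^o := pot s y + d * unit_exp ((mult s)%:~R * y).
exists (Stage m' l' r' h' n').
split.
- split; [exact: r'0|exact: add_character_continuous| |exact: leq_ltn_trans nn'].
  move=> y k; change (h' (y + k%:~R) = h' y).
  by rewrite /h' ph mulrDr -intrM unit_expDint.
- exact: nn'.
- exact: hk.
- by exists d; [|exact: H].
Qed.

Lemma cocycleS h b n :
  cocycle h b n.+1 = unit_exp b * cocycle h b n + coboundary h b (n%:R * a).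
Proof.
rewrite /cocycle /coboundary -natr1 !mulrDl !mul1r unit_expD.
by ring.
Qed.

(** The sequence [Z] is the fibre coordinate of the orbit of $(0, 0)$ under the
    limit map.  It stays within $4n 2^{-j}$ of the cocycle of stage $j$, and the
    cocycles of all stages after the visit to a target remain close to it. *)
Lemma cylinder_orbit_dense :
  exists b : R, exists rho : R -> R[i]^o,
  [/\ forall c d : rat, b != ratr c + ratr d * a,
      continuous rho,
      forall y (k : int), rho (y + k%:~R) = rho y &
      forall Z : nat -> R[i], Z 0%N = 0 ->
      (forall n, Z n.+1 = unit_exp b * Z n + rho (n%:R * a)) ->
      forall (x : R) (z : R[i]) (e : R), 0 < e ->
      exists n : nat, exists k : int,
        `|n%:R * a - k%:~R - x| < e /\ modulus (Z n - z) < e].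
Proof.
have [tgt tgtP] := @recurrent_enumeration (rat * rat * rat)%type (0, 0, 0).
have [avd avdP] := @recurrent_enumeration (rat * rat)%type (0, 0).
pose x j : R := ratr (tgt j).1.1.
pose z j : R[i] := Complex (ratr (tgt j).1.2) (ratr (tgt j).2).
pose q j : R := ratr (avd j).1 + ratr (avd j).2 * a.
pose e j : R := 2^-1 ^+ j.
have e0 j : 0 < e j by rewrite exprn_gt0 // invr_gt0.
have /choice[next nextP] : forall p : nat * stage, exists t, valid p.2 ->
    refines (e p.1) (x p.1) (q p.1) (z p.1) p.2 t.
  move=> [j s] /=.
  have [vs|nvs] := pselect (valid s); last by exists s.
  by have [t ht] := refines_exists (x j) (q j) (z j) (e0 j) vs; exists t.
pose st := fix st j := if j is i.+1 then next (i, st i)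
  else Stage 0 0 1 (fun=> 0) 1.
have st_valid j : valid (st j).
  elim: j => [|j IH]; last by have [] := nextP (j, st j) IH.
  by split; [exact: ltr01|move=> y; exact: cvg_cst| |].
have stP j : refines (e j) (x j) (q j) (z j) (st j) (st j.+1).
  exact: (nextP (j, st j) (st_valid j)).
have [b bP] : exists b, forall j, `|b - freq (st j)| <= rad (st j).
  have nest j t : `|t - freq (st j.+1)| <= rad (st j.+1) ->
      `|t - freq (st j)| <= rad (st j).
    by have [_ _ _ [d _ H]] := stP j => /H[].
  have rad0 j : 0 < rad (st j) by have [] := st_valid j.
  have [j|j|j|b hb] := @nested_intervals R
    (fun j => freq (st j) - rad (st j)) (fun j => freq (st j) + rad (st j)).
  - have := nest j (freq (st j.+1) - rad (st j.+1)); have := rad0 j.+1.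
    by rewrite !ler_norml => h /(_ _)/andP[]; lra.
  - have := nest j (freq (st j.+1) + rad (st j.+1)); have := rad0 j.+1.
    by rewrite !ler_norml => h /(_ _)/andP[]; lra.
  - by have := rad0 j; lra.
  by exists b => j; have := hb j; rewrite ler_norml; lra.
pose G j n := cocycle (pot (st j)) b n.
pose rho_ j y : R[i]^o := coboundary (pot (st j)) b y.
have G_step j n : (n <= time (st j))%N -> modulus (G j.+1 n - G j n) <= e j.
  move=> nt; have [_ _ _ [d potE H]] := stP j.
  have [_ _ /(_ n nt) + _] := H b (bP j.+1).
  rewrite /G /cocycle potE mulr0 unit_exp0.
  by congr (modulus _ <= _); ring.
have rho_step j y : modulus (rho_ j.+1 y - rho_ j y) <= e j.
  have [_ _ _ [d potE H]] := stP j; have [_ _ _ t0] := st_valid j.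
  have [_ _ /(_ 1%N t0) h _] := H b (bP j.+1).
  have -> : rho_ j.+1 y - rho_ j y = unit_exp ((mult (st j))%:~R * y) *
      (d * (unit_exp ((mult (st j))%:~R * (1%:R * a)) - unit_exp (1%:R * b))).
    rewrite /rho_ /coboundary potE [_ * (y + a)]mulrDr unit_expD.
    by rewrite mulr1n !mul1r; ring.
  by rewrite modulusM modulus_unit_exp mul1r.
have /choice[L LP] : forall u : nat -> R[i], exists l,
    (forall j, modulus (u j.+1 - u j) <= e j) ->
    forall j, modulus (l - u j) <= 4 * e j.
  move=> u.
  have [hu|nu] := pselect (forall j, modulus (u j.+1 - u j) <= e j).
    by have [l hl] := geometric_cauchy hu; exists l.
  by exists 0.
(* L depends only on the sequence, so rho inherits periodicity. *)
pose rho y : R[i]^o := L (fun j => rho_ j y).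
have rhoP y j : modulus (rho y - rho_ j y) <= 4 * e j.
  exact: (LP (fun j => rho_ j y) (fun j => rho_step j y)).
have rho_cont j : continuous (rho_ j).
  have [_ ch _ _] := st_valid j.
  move=> y; apply: cvgD.
    apply: (@continuous_comp _ _ _ (fun y : R => y + a)); last exact: ch.
    by apply: cvgD; [exact: cvg_id|exact: cvg_cst].
  by apply: cvgN; apply: cvgMl_tmp; exact: ch.
exists b, rho; split.
- move=> c d; have [j _ jcd] := avdP (c, d) 0%N.
  have [_ _ _ [d' _ H]] := stP j.
  by have [_ + _ _] := H b (bP j.+1); rewrite /q jcd.
- move=> y; apply/cvg_modulusP => eps eps0.
  have eps0' : 0 < eps / 12 by rewrite divr_gt0.
  have [j _ je] := half_power_small 0%N eps0'.
  have eps3 : 0 < eps / 3 by rewrite divr_gt0.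
  have /cvg_modulusP/(_ _ eps3) near_y := rho_cont j y.
  apply: filterS near_y => t ht.
  have h1 := modulus_dist_trans (rho_ j y) (rho y) (rho t).
  have h2 := modulus_dist_trans (rho_ j t) (rho_ j y) (rho t).
  have h3 := rhoP y j; have h4 := rhoP t j.
  rewrite modulus_distC in h4; move: je; rewrite -/(e j); lra.
- move=> y k; rewrite /rho; congr L; apply/funext => j.
  have [_ _ ph _] := st_valid j.
  by rewrite /rho_ /coboundary addrAC !ph.
move=> Z Z0 ZS x0 z0 eps eps0.
have ZG j n : modulus (Z n - G j n) <= n%:R * (4 * e j).
  elim: n => [|n IH].
    rewrite Z0 /G /cocycle !mul0r unit_exp0 mul1r subrr subr0.
    by rewrite Normc.normc0.
  rewrite ZS /G cocycleS -/(G j n) -natr1 mulrDl mul1r.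
  have -> : unit_exp b * Z n + rho (n%:R * a) -
      (unit_exp b * G j n + coboundary (pot (st j)) b (n%:R * a)) =
      unit_exp b * (Z n - G j n) + (rho (n%:R * a) - rho_ j (n%:R * a)).
    by rewrite /rho_; ring.
  apply: le_trans (modulusD _ _) _; rewrite modulusM modulus_unit_exp mul1r.
  exact: lerD.
have time_mono i j : (i <= j)%N -> (time (st i) <= time (st j))%N.
  apply: (@homo_leq _ (fun j => time (st j)) leq) => //; first exact: leq_trans.
  by move=> k; have [_ /ltnW] := stP k.
have eS j : e j.+1 = e j / 2 by rewrite /e exprSr.
have G_far j i n : (n <= time (st j))%N ->
    modulus (G (j + i)%N n - G j n) <= 2 * e j - 2 * e (j + i)%N.
  move=> nt; elim: i => [|i IH].
    by rewrite addn0 !subrr Normc.normc0.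
  rewrite addnS eS.
  have := G_step (j + i)%N n; rewrite (leq_trans nt) ?time_mono ?leq_addr //.
  move=> /(_ isT).
  have := modulus_dist_trans (G (j + i)%N n) (G (j + i).+1 n) (G j n).
  lra.
have visit j : modulus (Z (time (st j.+1)) - z j) < 4 * e j.
  set n := time (st j.+1).
  have [_ _ _ [d _ H]] := stP j.
  have [_ _ _ h1] := H b (bP j.+1).
  have h2 := G_far j.+1 n n (leqnn _).
  (* Comparing at stage j + 1 + n absorbs the factor n, as n <= 2 ^ n. *)
  have h3 := ZG (j.+1 + n)%N n.
  have h4 := modulus_dist_trans (G (j.+1 + n)%N n) (Z n) (z j).
  have h5 := modulus_dist_trans (G j.+1 n) (G (j.+1 + n)%N n) (z j).
  have h6 : n%:R * (4 * e (j.+1 + n)%N) <= 4 * e j.+1.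
    rewrite /e exprD mulrCA ler_pM2l // mulrCA ler_piMr ?(ltW (e0 _)) //.
    rewrite exprVn ler_pdivrMr ?exprn_gt0 // mul1r -natrX ler_nat.
    by rewrite ltnW // ltn_expl.
  have := e0 (j.+1 + n)%N; move: h2 h6; rewrite eS => h2 h6 h7.
  rewrite -/(G j.+1 n) in h1.
  lra.
have rat_near (t : R) : exists c : rat, `|ratr c - t| < eps / 4.
  have [|c] := @rat_in_itvoo R (t - eps / 4) (t + eps / 4); first lra.
  by rewrite in_itv /= => hc; exists c; rewrite ltr_norml; lra.
have [cx hx] := rat_near x0.
have [cr hr] := rat_near (complex.Re z0).
have [ci hi] := rat_near (complex.Im z0).
have eps0' : 0 < eps / 16 by rewrite divr_gt0.
have [N _ hN] := half_power_small 0%N eps0'.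
have [j Nj tj] := tgtP (cx, cr, ci) N.
have ej : e j < eps / 16.
  by apply: le_lt_trans hN; apply: ler_wiXn2l => //; rewrite invf_le1 ?ler1n.
have [_ _ [k hk] _] := stP j.
exists (time (st j.+1)), k; split.
  move: hk hx; rewrite /x tj /= !ltr_norml; lra.
have hz : modulus (z j - z0) < eps / 2.
  apply: le_lt_trans (modulus_ReIm _) _.
  rewrite /z tj; case: z0 hr hi => r0 i0 /= hr hi.
  by rewrite [ltRHS]splitr; apply: ltrD; rewrite -mulrA -invfM -natrM.
have := modulus_dist_trans (z j) (Z (time (st j.+1))) z0.
have := visit j; lra.
Qed.
End Construction.

(** * The circle and the cylinder map *)

Section Cylinder.
Variable R : realType.
Local Notation modulus := (@Normc.normc R).
Local Notation proj := (\pi_(circle R)%qT : R -> circle R).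

Lemma projP (x y : R) : reflect (exists k : int, x = y + k%:~R) (proj x == proj y).
Proof.
have -> : (proj x == proj y) = (x - y \in Num.int).
  (* The two equality tests come from different instances of decidable equality;
     the underlying classes are the same. *)
  have := Quotient.idealrBE (int_subgroup R) x y => /= ->.
  by apply/eqP/eqP => h; exact: h.
apply: (iffP intrP) => -[k hk]; exists k.
  by rewrite -hk addrC subrK.
by rewrite hk addrC addKr.
Qed.

Lemma projD (x y : R) : proj (x + y) = proj x + proj y.
Proof. exact: (@Quotient.pi_add R (int_subgroup R) x y). Qed.

Lemma proj0 : proj 0 = 0.
Proof. by apply: (addrI (proj 0)); rewrite -projD !addr0. Qed.

Lemma proj_repr (c : circle R) : proj (repr c) = c.
Proof. exact: reprK. Qed.

Lemma proj_continuous : continuous proj.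
Proof. exact: pi_continuous. Qed.

Lemma translation_continuous (a : R) : continuous (fun c : circle R => c + proj a).
Proof.
apply/quotient_continuous => x.
rewrite (_ : _ \o _ = (fun y => proj (y + a))); last first.
  by apply/funext => y /=; rewrite projD.
apply: (@continuous_comp _ _ _ (fun y : R => y + a) proj).
  by apply: cvgD; [exact: cvg_id|exact: cvg_cst].
exact: proj_continuous.
Qed.

Lemma cylinder_mapE (a b : R) (rho : circle R -> R[i]^o) c z :
  cylinder_map a b rho (c, z) = (c + proj a, unit_exp b * z + rho c).
Proof. by rewrite /cylinder_map /= cexp_unit_exp. Qed.

Lemma cylinder_map_continuous (a b : R) (rho : circle R -> R[i]^o) :
  continuous rho -> continuous (cylinder_map a b rho).
Proof.
move=> crho.
have base : continuous (fun p : circle R * R[i]^o => p.1 + proj a).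
  move=> p; apply: (@continuous_comp _ _ _ fst (fun c : circle R => c + proj a)).
    exact: cvg_fst.
  exact: translation_continuous.
have fibre : continuous (fun p : circle R * R[i]^o =>
    cexp ((2 * pi)%:C%C * 'i * b%:C%C) * p.2 + rho p.1 : R[i]^o).
  move=> p; apply: cvgD; first by apply: cvgMl_tmp; exact: cvg_snd.
  by apply: (@continuous_comp _ _ _ fst rho); [exact: cvg_fst|exact: crho].
by move=> p; exact: (cvg_pair (base p) (fibre p)).
Qed.

(** The inverse is again a cylinder map, with angles [- a] and [- b]. *)
Lemma cylinder_map_homeomorphism (a b : R) (rho : circle R -> R[i]^o) :
  continuous rho -> homeomorphism (cylinder_map a b rho).
Proof.
move=> crho; split; first exact: cylinder_map_continuous.
pose rho' (c : circle R) : R[i]^o := - (unit_exp (- b) * rho (c + proj (- a))).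
have pK : proj a + proj (- a) = 0 by rewrite -projD subrr proj0.
exists (cylinder_map (- a) (- b) rho'); split.
- move=> [c z]; rewrite [cylinder_map a _ _ _]cylinder_mapE cylinder_mapE /rho' -addrA pK addr0.
  by rewrite mulrDr mulrA unit_expN mul1r addrK.
- move=> [c z]; rewrite [cylinder_map (- a) _ _ _]cylinder_mapE cylinder_mapE /rho' -addrA [proj (- a) + _]addrC pK addr0.
  have E : unit_exp b * unit_exp (- b) = 1 :> R[i] by rewrite mulrC unit_expN.
  by rewrite mulrBr !mulrA E !mul1r subrK.
- have crho' : continuous (fun c : circle R => rho (c + proj (- a))).
    move=> c; apply: (@continuous_comp _ _ _ (fun c : circle R => c + proj (- a))).
      exact: translation_continuous.
    exact: crho.
  apply: cylinder_map_continuous => c.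
  exact: (cvgN (cvgMl_tmp (a := unit_exp (- b) : R[i]^o) (crho' c))).
Qed.

Lemma nbhs_modulus (z : R[i]^o) (V : set (R[i]^o)) : nbhs z V ->
  exists2 e : R, 0 < e & forall w, modulus (w - z) < e -> V w.
Proof.
move=> /nbhs_ballP[e /= e0 h].
have [r r0 er] := gt0_complex_real e0.
exists r => // w wz; apply: h.
by rewrite /ball /= er norm_modulus modulus_distC ltcR.
Qed.

Lemma dense_cylinder (A : set (circle R * R[i]^o)) :
  (forall (x : R) (z : R[i]) (e : R), 0 < e -> exists y w, A (proj y, w) /\
     (`|y - x| < e /\ modulus (w - z) < e)) ->
  dense A.
Proof.
move=> H O [[c z] Ocz] oO.
have : nbhs (c, z) O by exact: open_nbhs_nbhs.
rewrite -(proj_repr c) => -[[U V] /= [nU nV] UV].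
have /nbhs_ballP[e1 /= e10 h1] := proj_continuous nU.
have [e2 e20 h2] := nbhs_modulus nV.
have e0 : 0 < Num.min e1 e2 by rewrite lt_min e10.
have [y [w [Ayw]]] := H (repr c) z _ e0.
rewrite !lt_min => -[/andP[y1 _] /andP[_ w2]].
exists (proj y, w); split => //; apply: UV; split => /=; last exact: h2.
by apply: h1; rewrite /ball /= distrC.
Qed.
End Cylinder.

(** * Rational independence and transitivity *)

Lemma lin_indep_rat3 (R : realType) (a b : R) :
  (forall c : rat, ratr c != a) ->
  (forall c d : rat, b != ratr c + ratr d * a) ->
  lin_indep_rat [tuple 1; a; b].
Proof.
move=> irr indep c; rewrite !big_ord_recl big_ord0 addr0 !(tnth_nth 0) /= mulr1.
set c0 := c _; set c1 := c _; set c2 := c _ => sum0.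
have c20 : c2 = 0.
  apply/eqP/negPn/negP => c2n0.
  have r2 : ratr c2 != 0 :> R by rewrite fmorph_eq0.
  have /eqP[] := indep (- c0 / c2) (- c1 / c2).
  rewrite !fmorph_div !rmorphN /= -[LHS](mulKf r2).
  have -> : ratr c2 * b = - ratr c0 - ratr c1 * a by lra.
  by field.
have c10 : c1 = 0.
  apply/eqP/negPn/negP => c1n0.
  have r1 : ratr c1 != 0 :> R by rewrite fmorph_eq0.
  have /eqP[] := irr (- c0 / c1).
  rewrite fmorph_div rmorphN /= -[RHS](mulKf r1).
  have -> : ratr c1 * a = - ratr c0.
    by move: sum0; rewrite c20 rmorph0 mul0r; lra.
  by rewrite mulrC.
have c00 : c0 = 0.
  apply/eqP; rewrite -(fmorph_eq0 (ratr : rat -> R)) -sum0 c10 c20.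
  by rewrite rmorph0 !mul0r !addr0.
move=> -[[|[|[|//]]] hi].
- by rewrite -c00; congr c; apply/val_inj.
- by rewrite -c10; congr c; apply/val_inj.
- by rewrite -c20; congr c; apply/val_inj.
Qed.

Theorem mainTheorem2 (R : realType) :
  exists alpha beta : R,
    lin_indep_rat [tuple 1; alpha; beta] /\
    exists rho : circle R -> R[i]^o,
      [/\ continuous rho,
          homeomorphism (cylinder_map alpha beta rho) &
          topologically_transitive (cylinder_map alpha beta rho)].
Proof.
pose a : R := Num.sqrt 2.
have irr : forall q : rat, ratr q != a by exact: sqrt2_irrational.
have [b [rho [indep crho prho orbit]]] := cylinder_orbit_dense irr.
exists a, b; split.
  exact: lin_indep_rat3.
pose rhoC : circle R -> R[i]^o := rho \o repr.
have rhoCE y : rhoC (\pi_(circle R)%qT y) = rho y.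
  rewrite /rhoC /=.
  have /eqP/projP[k ->] := proj_repr (\pi_(circle R)%qT y).
  exact: prho.
have crhoC : continuous rhoC.
  by apply: repr_comp_continuous => // x y /projP[k ->]; rewrite prho.
exists rhoC; split => //; first exact: cylinder_map_homeomorphism.
pose F := cylinder_map a b rhoC.
pose Z n : R[i] := (iter n F (\pi_(circle R)%qT 0, 0)).2.
have FZ n : iter n F (\pi_(circle R)%qT 0, 0) = (\pi_(circle R)%qT (n%:R * a), Z n).
  rewrite [LHS]surjective_pairing; congr pair.
  elim: n => [|n IH]; first by rewrite mul0r.
  by rewrite iterS /F /cylinder_map -/F /= IH -natr1 mulrDl mul1r projD.
exists (\pi_(circle R)%qT 0, 0); apply: dense_cylinder => x z e e0.
have [|n|n [k [nk nz]]] := orbit Z _ _ x z e e0; first by [].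
  by rewrite {1}/Z iterS FZ /F cylinder_mapE /= rhoCE.
exists (n%:R * a - k%:~R), (Z n); split; last by split.
exists n; left; rewrite FZ; congr pair; apply/eqP/projP.
by exists (- k); rewrite rmorphN.
Qed.
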